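(* If $(A,G,\alpha)$ is a free dynamical system, then the induced action $$\sigma:\Gamma_A\times G\to\Gamma_A,\qquad(\chi,g)\mapsto\chi\circ\alpha(g)$$ of $G$ on the spectrum $\Gamma_A$ of $A$ is free (all stabilizers are trivial).
   Context: Algebras are complex. A dynamical system $(A,G,\alpha)$ consists of a unital locally convex algebra $A$, a topological group $G$ and a group homomorphism $\alpha:G\to\mathrm{Aut}(A)$ such that the action map $G\times A\to A$ is continuous. $\Gamma_A:=\mathrm{Hom}_{\mathrm{alg}}(A,\mathbb{C})\setminus\{0\}$ is the spectrum of $A$, with the topology of pointwise convergence. A family $(\pi_j,V_j)_{j\in J}$ of (continuous) representations of $G$ separates the points of $G$ (is point separating) if for each $g\neq 1_G$ there is $j\in J$ with $\pi_j(g)\neq\mathrm{id}_{V_j}$. For a representation $(\pi,V)$ of $G$ put $$\Gamma_A V:=(A\otimes V)^G=\{s\in A\otimes V:\ (\alpha(g)\otimes\pi(g))(s)=s\ \text{for all } g\in G\}.$$ A dynamical system $(A,G,\alpha)$ with $A$ commutative is called free if there exists a point separating family $(\pi_j,V_j)_{j\in J}$ of representations of $G$ such that for all $j\in J$ and all $\chi\in\Gamma_A$ the map $\mathrm{ev}^j_\chi:\Gamma_A V_j\to V_j$, $a\otimes v\mapsto\chi(a)\cdot v$ (the restriction of $\chi\otimes\mathrm{id}_{V_j}$) is surjective. *)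

(* Defs.v *)
From HB Require Import structures.
From mathcomp Require Import all_boot all_order all_algebra generic_quotient.
From mathcomp Require Import complex.
From mathcomp Require Import all_classical all_reals all_analysis.
From mathcomp Require Import freeg.

Set Implicit Arguments.
Unset Strict Implicit.
Unset Printing Implicit Defensive.

Import Order.TTheory GRing.Theory Num.Theory.
Import numFieldNormedType.Exports.

Local Open Scope classical_set_scope.
Local Open Scope ring_scope.
Local Open Scope quotient_scope.

HB.mixin Record isTopologicalGroup G & Topological G & Group G := {
  mulg_continuous : continuous (fun p : G * G => (p.1 * p.2)%g);
  invg_continuous : continuous (fun g : G => g^-1%g)
}.

#[short(type="topGroupType")]
HB.structure Definition TopologicalGroup :=
  {G of isTopologicalGroup G & Topological G & Group G}.

(* [tvsType K] is the library's class of locally convex spaces. *)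
HB.mixin Record isTopologicalAlgebra (K : numFieldType) A
    & Topological A & GRing.Algebra K A := {
  mulr_continuous : continuous (fun p : A * A => (p.1 * p.2 : A))
}.

#[short(type="lcAlgType")]
HB.structure Definition LocallyConvexAlgebra (K : numFieldType) :=
  {A of isTopologicalAlgebra K A & Tvs K A & GRing.Algebra K A}.

Section TensorProduct.
Variables (K : fieldType) (A V : lmodType K).

(* The algebraic tensor product is the quotient of the free vector space on
   A * V by the subspace generated by the bilinearity relations. *)
Local Notation F := {freeg (A * V)%type / K}.

Inductive tensor_relations : F -> Prop :=
| TensorRel0 : tensor_relations 0
| TensorRelD x y :
    tensor_relations x -> tensor_relations y -> tensor_relations (x + y)
| TensorRelZ (c : K) x : tensor_relations x -> tensor_relations (c *: x)
| TensorRelAddl a b v :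
    tensor_relations (<< (a + b, v) >> - << (a, v) >> - << (b, v) >>)
| TensorRelAddr a v w :
    tensor_relations (<< (a, v + w) >> - << (a, v) >> - << (a, w) >>)
| TensorRelScalel (c : K) a v :
    tensor_relations (<< (c *: a, v) >> - c *: << (a, v) >>)
| TensorRelScaler (c : K) a v :
    tensor_relations (<< (a, c *: v) >> - c *: << (a, v) >>).

Definition tensor_eqv (x y : F) : bool := `[< tensor_relations (x - y) >].

Lemma tensor_relationsN x : tensor_relations x -> tensor_relations (- x).
Proof. by rewrite -scaleN1r; apply: TensorRelZ. Qed.

Lemma tensor_eqv_refl : reflexive tensor_eqv.
Proof. by move=> x; apply/asboolP; rewrite subrr; constructor. Qed.

Lemma tensor_eqv_sym : symmetric tensor_eqv.
Proof.
by move=> x y; apply/asboolP/asboolP => /tensor_relationsN; rewrite opprB.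
Qed.

Lemma tensor_eqv_trans : transitive tensor_eqv.
Proof.
move=> y x z /asboolP xy /asboolP yz; apply/asboolP.
by rewrite -(subrKA y); exact: TensorRelD.
Qed.

Canonical tensor_eqv_equiv :=
  EquivRel tensor_eqv tensor_eqv_refl tensor_eqv_sym tensor_eqv_trans.

Definition tensor := {eq_quot tensor_eqv}.

HB.instance Definition _ := Choice.on tensor.
HB.instance Definition _ := Quotient.on tensor.
HB.instance Definition _ : EqQuotient _ tensor_eqv tensor :=
  EqQuotient.on tensor.

Lemma tensor_piP (x y : F) :
  tensor_relations (x - y) <-> \pi_tensor x = \pi_tensor y.
Proof.
by split=> [xy|/eqmodP/asboolP//]; apply/eqmodP; apply/asboolP.
Qed.

Lemma tensor_repr (x : F) : tensor_relations (repr (\pi_tensor x) - x).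
Proof. by apply/tensor_piP; rewrite reprK. Qed.

Definition tensor_add (s t : tensor) := \pi_tensor (repr s + repr t).
Definition tensor_opp (s : tensor) := \pi_tensor (- repr s).
Definition tensor_scale (c : K) (s : tensor) := \pi_tensor (c *: repr s).

Lemma tensor_piD x y :
  \pi_tensor (x + y) = tensor_add (\pi_tensor x) (\pi_tensor y).
Proof.
apply/esym/tensor_piP; rewrite opprD addrACA.
by apply: TensorRelD; exact: tensor_repr.
Qed.

Lemma tensor_piN x : \pi_tensor (- x) = tensor_opp (\pi_tensor x).
Proof.
apply/esym/tensor_piP; rewrite -opprD.
by apply: tensor_relationsN; exact: tensor_repr.
Qed.

Lemma tensor_piZ c x : \pi_tensor (c *: x) = tensor_scale c (\pi_tensor x).
Proof.
apply/esym/tensor_piP; rewrite -scalerBr.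
by apply: TensorRelZ; exact: tensor_repr.
Qed.

Lemma tensor_addA : associative tensor_add.
Proof.
elim/quotW=> x; elim/quotW=> y; elim/quotW=> z.
by rewrite -(tensor_piD y z) -(tensor_piD x y) -(tensor_piD x) -(tensor_piD _ z) addrA.
Qed.

Lemma tensor_addC : commutative tensor_add.
Proof. by move=> s t; rewrite /tensor_add addrC. Qed.

Lemma tensor_add0 : left_id (\pi_tensor 0) tensor_add.
Proof. by elim/quotW=> x; rewrite -tensor_piD add0r. Qed.

Lemma tensor_addN : left_inverse (\pi_tensor 0) tensor_opp tensor_add.
Proof. by elim/quotW=> x; rewrite -(tensor_piN x) -tensor_piD addNr. Qed.

HB.instance Definition _ := GRing.isZmodule.Build tensor
  tensor_addA tensor_addC tensor_add0 tensor_addN.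

Lemma tensor_scaleA a b s :
  tensor_scale a (tensor_scale b s) = tensor_scale (a * b) s.
Proof. by elim/quotW: s => x; rewrite -(tensor_piZ b x) -!tensor_piZ scalerA. Qed.

Lemma tensor_scale1 : left_id 1 tensor_scale.
Proof. by elim/quotW=> x; rewrite -tensor_piZ scale1r. Qed.

Lemma tensor_scaleDr : right_distributive tensor_scale +%R.
Proof.
move=> c; elim/quotW=> x; elim/quotW=> y.
rewrite -[LHS]/(tensor_scale c (tensor_add (\pi x) (\pi y))) -tensor_piD.
by rewrite -(tensor_piZ c (x + y)) scalerDr tensor_piD !tensor_piZ.
Qed.

Lemma tensor_scaleDl s : {morph tensor_scale^~ s : a b / a + b}.
Proof.
move=> a b; elim/quotW: s => x.
by rewrite -(tensor_piZ (a + b) x) scalerDl tensor_piD !tensor_piZ.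
Qed.

HB.instance Definition _ := GRing.Zmodule_isLmodule.Build K tensor
  tensor_scaleA tensor_scale1 tensor_scaleDr tensor_scaleDl.

Definition tens (a : A) (v : V) : tensor := \pi_tensor << (a, v) >>.

Definition bilinear_map (W : lmodType K) (f : A -> V -> W) : Prop :=
  (forall v, linear (f^~ v)) /\ (forall a, linear (f a)).

Lemma tens_bilinear : bilinear_map tens.
Proof.
have aux a v a' v' a'' v'' (c : K) x y :
  tensor_relations (<<(a, v)>> - y - <<(a'', v'')>>) ->
  tensor_relations (x - c *: <<(a', v')>>) -> y = x ->
  tens a v = c *: tens a' v' + tens a'' v''.
  move=> r1 r2 yx; rewrite -[RHS]/(tensor_add (tensor_scale _ _) _).
  rewrite -(tensor_piZ c <<(a', v')>>) -tensor_piD; apply/tensor_piP.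
  have := TensorRelD r1 r2; rewrite yx.
  by rewrite addrAC addrA subrK -addrA -opprD [in X in _ - X]addrC.
split=> [v c a b|a c v w].
  exact: (aux _ _ _ _ _ _ _ _ _ (TensorRelAddl _ _ _) (TensorRelScalel _ _ _)).
exact: (aux _ _ _ _ _ _ _ _ _ (TensorRelAddr _ _ _) (TensorRelScaler _ _ _)).
Qed.

Section Lift.
Variable W : lmodType K.

(* The linear map on the tensor product induced by f; it is independent of the
   choice of representatives when f is bilinear (see [tensor_lift_tens]). *)
Definition tensor_lift (f : A -> V -> W) (s : tensor) : W :=
  fglift (fun p => f p.1 p.2) (repr s).

Variable f : A -> V -> W.
Hypothesis fB : bilinear_map f.

Let L : F -> W := fglift (fun p => f p.1 p.2).

Let LB x y : L (x - y) = L x - L y. Proof. exact: lift_is_additive. Qed.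

Let L_0 : L 0 = 0. Proof. by rewrite -[in LHS](subrr 0) LB subrr. Qed.

Let LD : {morph L : x y / x + y}.
Proof. by move=> x y; rewrite -{1}[y]opprK -(sub0r y) !LB L_0 sub0r opprK. Qed.

Let LU k p : L << k *g p >> = k *: f p.1 p.2.
Proof. exact: liftU. Qed.

Let LZ c x : L (c *: x) = c *: L x.
Proof.
rewrite -(freeg_sumE x) scaler_sumr.
rewrite !(big_morph L LD L_0) scaler_sumr; apply: eq_bigr => p _.
have -> : c *: << coeff p x *g p >> = << c * coeff p x *g p >> :> F.
  by apply/eqP/freeg_eqP => q; rewrite coeffZ !coeffU mulrA.
by rewrite !LU scalerA.
Qed.

Let L0 x : tensor_relations x -> L x = 0.
Proof.
have [fl fr] := fB.
have fDl a b v : f (a + b) v = f a v + f b v.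
  by have := fl v 1 a b; rewrite /= !scale1r.
have fDr a v w : f a (v + w) = f a v + f a w.
  by have := fr a 1 v w; rewrite /= !scale1r.
have f0l v : f 0 v = 0 by apply: (addrI (f 0 v)); rewrite -fDl !addr0.
have f0r a : f a 0 = 0 by apply: (addrI (f a 0)); rewrite -fDr !addr0.
elim=> {x} [|x y _ Lx _ Ly|c x _ Lx|a b v|a v w|c a v|c a v].
- exact: L_0.
- by rewrite LD Lx Ly addr0.
- by rewrite LZ Lx scaler0.
- by rewrite !LB !LU /= !scale1r fDl addrAC addrK subrr.
- by rewrite !LB !LU /= !scale1r fDr addrAC addrK subrr.
- rewrite LB LZ !LU /= !scale1r.
  by have := fl v c a 0; rewrite /= f0l !addr0 => ->; rewrite subrr.
- rewrite LB LZ !LU /= !scale1r.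
  by have := fr a c v 0; rewrite /= f0r !addr0 => ->; rewrite subrr.
Qed.

Lemma tensor_lift_pi x : tensor_lift f (\pi_tensor x) = L x.
Proof. by apply/eqP; rewrite -subr_eq0 -LB L0//; exact: tensor_repr. Qed.

Lemma tensor_lift_tens a v : tensor_lift f (tens a v) = f a v.
Proof. by rewrite tensor_lift_pi LU scale1r. Qed.

Lemma tensor_lift_linear : linear (tensor_lift f).
Proof.
move=> c; elim/quotW=> x; elim/quotW=> y.
rewrite -[X in tensor_lift f X = _]/(tensor_add (tensor_scale c (\pi x)) (\pi y)).
rewrite -(tensor_piZ c x) -tensor_piD !tensor_lift_pi.
by rewrite LD LZ.
Qed.

End Lift.

(* Every tensor is a finite sum of elementary ones. *)
Lemma tensor_sum_tens (s : tensor) :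
  exists r : seq (A * V), s = \sum_(p <- r) tens p.1 p.2.
Proof.
exists [seq (coeff p (repr s) *: p.1, p.2) | p <- dom (repr s)].
have pi0 : \pi_tensor 0 = 0 :> tensor by [].
rewrite big_map -[LHS]reprK -[in LHS](freeg_sumE (repr s)).
rewrite (big_morph \pi_tensor tensor_piD pi0); apply: eq_bigr => -[a v] _ /=.
set c := coeff _ _; apply/esym/tensor_piP.
have -> : << c *g (a, v) >> = c *: << (a, v) >> :> F.
  by apply/eqP/freeg_eqP => q; rewrite coeffZ !coeffU mul1r.
exact: TensorRelScalel.
Qed.

End TensorProduct.

Definition tensor_map (K : fieldType) (A A' V V' : lmodType K)
    (f : A -> A') (h : V -> V') : tensor A V -> tensor A' V' :=
  tensor_lift (fun a v => tens (f a) (h v)).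

Lemma tensor_map_tens (K : fieldType) (A A' V V' : lmodType K)
    (f : {linear A -> A'}) (h : {linear V -> V'}) a v :
  tensor_map f h (tens a v) = tens (f a) (h v).
Proof.
have [tl tr] := @tens_bilinear K A' V'; rewrite /tensor_map tensor_lift_tens//.
split=> [w c b b'|b c w w']; rewrite linearP; [exact: tl|exact: tr].
Qed.

(* The conditions make each [ds_act g] an automorphism of the topological
   algebra A, and [ds_act] a group homomorphism G -> Aut(A). *)
Record dynamical_system (K : numFieldType) (A : lcAlgType K)
    (G : topGroupType) := DynamicalSystem {
  ds_act :> G -> {lrmorphism A -> A};
  ds_act1 : forall a, ds_act 1%g a = a;
  ds_actM : forall g h a, ds_act (g * h)%g a = ds_act g (ds_act h a);
  ds_act_continuous : continuous (fun p : G * A => ds_act p.1 p.2)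
}.

Record representation (K : numFieldType) (G : topGroupType)
    (V : topologicalLmodType K) := Representation {
  repr_act :> G -> {linear V -> V};
  repr_act1 : forall v, repr_act 1%g v = v;
  repr_actM : forall g h v, repr_act (g * h)%g v = repr_act g (repr_act h v);
  repr_act_continuous : continuous (fun p : G * V => repr_act p.1 p.2)
}.

Definition point_separating (K : numFieldType) (G : topGroupType) (J : Type)
    (V : J -> topologicalLmodType K) (pi : forall j, representation G (V j)) :=
  forall g : G, g <> 1%g -> exists j, pi j g <> idfun :> (V j -> V j).

Section Spectrum.
Variables (K : numFieldType) (A : algType K).

(* No unitality is imposed (a nonzero multiplicative functional is
   automatically unital), and no continuity either. *)
Definition spectrum : set (A -> K) :=
  [set chi | [/\ linear (chi : A -> K^o),
                 {morph chi : a b / a * b} & chi <> (fun=> 0)]].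

End Spectrum.

Section FreeSystem.
Variables (K : numFieldType) (A : lcAlgType K) (G : topGroupType).
Variable alpha : dynamical_system A G.

Definition invariant_tensors (V : topologicalLmodType K)
    (pi : representation G V) : set (tensor A V) :=
  [set s | forall g, tensor_map (alpha g) (pi g) s = s].

Definition evaluation (V : topologicalLmodType K) (chi : A -> K) :
    tensor A V -> V :=
  tensor_lift (fun a v => chi a *: v).

Lemma evaluation_tens (V : topologicalLmodType K) (chi : A -> K) a (v : V) :
  spectrum chi -> evaluation chi (tens a v) = chi a *: v.
Proof.
move=> [chiL _ _]; rewrite /evaluation tensor_lift_tens//.
split=> [w c b b'|b c w w'].
  by rewrite chiL scalerDl -scalerA.
by rewrite scalerDr !scalerA mulrC.
Qed.

Definition free_system : Prop :=
  exists (J : Type) (V : J -> topologicalLmodType K)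
         (pi : forall j, representation G (V j)),
    point_separating pi /\
    forall j chi, spectrum chi ->
      set_surj (invariant_tensors (pi j)) [set: V j] (evaluation chi).

Lemma spectrum_comp (chi : A -> K) (g : G) :
  spectrum chi -> spectrum (chi \o alpha g).
Proof.
move=> [chiL chiM chi0]; split.
- by move=> c a b /=; rewrite linearP; exact: chiL.
- by move=> a b /=; rewrite rmorphM chiM.
- move=> chig0; apply: chi0; apply/funext => a.
  have := congr1 (fun f => f (alpha g^-1%g a)) chig0.
  by rewrite /= -ds_actM mulgV ds_act1.
Qed.

Definition spectrum_action (chi : spectrum (A := A)) (g : G) :
    spectrum (A := A) :=
  SigSub (mem_set (spectrum_comp g (set_valP chi))).

Lemma spectrum_action1 chi : spectrum_action chi 1%g = chi.
Proof. by apply/val_inj/funext => a /=; rewrite ds_act1. Qed.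

Lemma spectrum_actionM chi g h :
  spectrum_action chi (g * h)%g = spectrum_action (spectrum_action chi g) h.
Proof. by apply/val_inj/funext => a /=; rewrite ds_actM. Qed.

End FreeSystem.

Definition right_stabilizer (G : groupType) (X : Type) (sigma : X -> G -> X)
    (x : X) : set G := [set g | sigma x g = x].

Definition free_right_action (G : groupType) (X : Type)
    (sigma : X -> G -> X) : Prop :=
  forall x, right_stabilizer sigma x = [set 1%g].

(* Main.v *)
Require Import Defs.
From HB Require Import structures.
From mathcomp Require Import all_boot all_order all_algebra complex.
From mathcomp Require Import all_classical all_reals all_analysis.
Import GRing.Theory.
Import numFieldNormedType.Exports.
Local Open Scope ring_scope.

(** Evaluation intertwines the two actions: for a character [chi] and a
    representation [pi], evaluating [(alpha g (x) pi g) s] at [chi] is applying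
    [pi g] to the evaluation of [s] at [chi \o alpha g]
    ([evaluation_tensor_map]); this holds because both sides are linear in [s]
    and agree on elementary tensors.

    If [g] fixes [chi] and [s] is invariant, the identity reads
    [ev_chi s = pi g (ev_chi s)], so [pi g] fixes the image of the invariant
    tensors under [ev_chi].  Freeness of the system makes that image the whole
    of [V j] for every [j], so [g] acts trivially in each member of a
    point-separating family, that is, [g = 1]. *)

(** The uniqueness half of the universal property of the tensor product. *)
Lemma eq_linear_tens (K : fieldType) (A V W : lmodType K)
    (f h : tensor A V -> W) :
  linear f -> linear h -> (forall a v, f (tens a v) = h (tens a v)) -> f =1 h.
Proof.
move=> fL hL fh s; have [r ->] := tensor_sum_tens s.
have lin0 (k : tensor A V -> W) : linear k -> k 0 = 0.
  by move=> kL; have := kL (-1) 0 0; rewrite scaler0 addr0 scaleN1r addNr.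
elim: r => [|p r IHr]; first by rewrite big_nil !lin0.
by rewrite big_cons -[tens _ _]scale1r fL hL fh IHr.
Qed.

Lemma tensor_map_linear (K : fieldType) (A A' V V' : lmodType K)
    (f : {linear A -> A'}) (h : {linear V -> V'}) :
  linear (tensor_map f h).
Proof.
have [tl tr] := @tens_bilinear K A' V'; apply: tensor_lift_linear.
by split=> [w c b b'|b c w w']; rewrite linearP; [exact: tl|exact: tr].
Qed.

Lemma evaluation_linear (K : numFieldType) (A : lcAlgType K)
    (V : topologicalLmodType K) (chi : A -> K) :
  spectrum chi -> linear (@evaluation K A V chi).
Proof.
move=> [chiL _ _]; apply: tensor_lift_linear; split=> [w c b b'|b c w w'].
  by rewrite chiL scalerDl -scalerA.
by rewrite scalerDr !scalerA mulrC.
Qed.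

(** Equivariance of evaluation: the action on the algebra factor moves the
    character and the action on the vector factor comes out, so a character
    fixed by [g] evaluates invariant tensors to vectors fixed by [pi g]. *)
Lemma evaluation_tensor_map (K : numFieldType) (A : lcAlgType K)
    (G : topGroupType) (alpha : dynamical_system A G)
    (V : topologicalLmodType K) (pi : representation G V) (chi : A -> K)
    (g : G) (s : tensor A V) :
  spectrum chi ->
  evaluation chi (tensor_map (alpha g) (pi g) s) =
  pi g (evaluation (chi \o alpha g) s).
Proof.
move=> chiS; have chigS := @spectrum_comp _ _ _ alpha chi g chiS.
move: s; apply: eq_linear_tens => [c s t|c s t|a v].
- by rewrite tensor_map_linear evaluation_linear.
- by rewrite evaluation_linear// linearP.
- by rewrite tensor_map_tens !evaluation_tens// linearZ.
Qed.

Theorem theorem3p11 (R : realType) (A : lcAlgType R[i]) (G : topGroupType)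
    (mulA_comm : forall a b : A, a * b = b * a)
    (alpha : dynamical_system A G) :
  free_system alpha -> free_right_action (spectrum_action alpha).
Proof.
move=> [J [V [pi [sep surj]]]] chi; apply/seteqP; split=> g; last first.
  by move=> ->; exact: spectrum_action1.
rewrite /right_stabilizer /= => chi_fix; apply: contrapT => /sep[j]; apply.
have chiS := set_valP chi.
have chigE : set_val chi \o alpha g = set_val chi.
  exact: (congr1 set_val chi_fix).
apply/funext => v; have [s s_inv <-] := surj j _ chiS v I.
have := @evaluation_tensor_map _ _ _ alpha _ (pi j) _ g s chiS.
by rewrite s_inv chigE => <-.
Qed.
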